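(* Let $\phi,\theta\in[0,\pi]$ and $\Psi=\sin\phi\sin\theta$. Let $\mathsf{G}_{\mathsf{eva}}^{\mathsf{upa}}$ and $\mathsf{G}_{\mathsf{rad}}^{\mathsf{upa}}$ be the asymptotic channel gains of the spatially-discrete planar array with and without the reactive terms, and let $\tilde{\mathsf{G}}_{\mathsf{eva}}^{\mathsf{upa}}$ and $\tilde{\mathsf{G}}_{\mathsf{rad}}^{\mathsf{upa}}$ be those of the continuous-aperture planar array, as given in the context. Then $$\frac{\mathsf{G}_{\mathsf{eva}}^{\mathsf{upa}}}{\mathsf{G}_{\mathsf{rad}}^{\mathsf{upa}}}=1-\frac{1}{12\pi^2}\frac{\lambda^2}{r^2\Psi^2}+\frac{1}{80\pi^4}\frac{\lambda^4}{r^4\Psi^4},$$ the value of which is less than $1$ when $r\Psi>\left(\frac{3}{20}\right)^{1/2}\frac{\lambda}{\pi}\approx 0.12\lambda$. The ratio $\tilde{\mathsf{G}}_{\mathsf{eva}}^{\mathsf{upa}}/\tilde{\mathsf{G}}_{\mathsf{rad}}^{\mathsf{upa}}$ for the continuous-aperture array is equal to the same expression.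
   Context: Parameters: $r>0$ is the distance from the user to the array center, $\phi,\theta\in[0,\pi]$ are the azimuth and elevation angles, $\lambda>0$ is the wavelength, $\sqrt{A}>0$ is the side length of each antenna element, $d\ge\sqrt{A}$ is the element spacing, $\eta=120\pi$ is the free-space impedance, and $\mathsf{R}_{\mathsf{rad}}>0$ is the radiation resistance. Notation: $\Phi=\cos\phi\sin\theta$, $\Psi=\sin\phi\sin\theta$, $\Theta=\cos\theta$, $k_0=\frac{2\pi}{\lambda}$, $\varepsilon=\frac{d}{r}$. For $n\in\{3,5,7\}$ define $$f_n(x,z)=\big((x-\Phi)^2+\Psi^2+(z-\Theta)^2\big)^{-n/2},$$ and set $F(x,z)=f_3(x,z)-\frac{1}{k_0^2r^2}f_5(x,z)+\frac{1}{k_0^4r^4}f_7(x,z)$; the terms with $f_5$ and $f_7$ are the reactive terms. Spatially-discrete array: for odd positive integers $M_x,M_z$ (numbers of elements along the two axes) let $\mathcal{H}=[-\frac{M_x\varepsilon}{2},\frac{M_x\varepsilon}{2}]\times[-\frac{M_z\varepsilon}{2},\frac{M_z\varepsilon}{2}]$ and $$\mathsf{G}_{\mathsf{eva}}^{\mathsf{upa}}=\lim_{M_x,M_z\to\infty}\frac{\eta}{8\,\mathsf{R}_{\mathsf{rad}}}\frac{A\Psi}{4\pi d^2}\iint_{\mathcal{H}}F\,dx\,dz,\qquad \mathsf{G}_{\mathsf{rad}}^{\mathsf{upa}}=\lim_{M_x,M_z\to\infty}\frac{\eta}{8\,\mathsf{R}_{\mathsf{rad}}}\frac{A\Psi}{4\pi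 d^2}\iint_{\mathcal{H}}f_3\,dx\,dz.$$ Continuous-aperture array: for side lengths $L_x,L_z>0$ let $\tilde{\mathcal{H}}=[-\frac{L_x}{2r},\frac{L_x}{2r}]\times[-\frac{L_z}{2r},\frac{L_z}{2r}]$ and $$\tilde{\mathsf{G}}_{\mathsf{eva}}^{\mathsf{upa}}=\lim_{L_x,L_z\to\infty}\frac{\eta}{8\,\mathsf{R}_{\mathsf{rad}}}\frac{\Psi}{4\pi}\iint_{\tilde{\mathcal{H}}}F\,dx\,dz,\qquad \tilde{\mathsf{G}}_{\mathsf{rad}}^{\mathsf{upa}}=\lim_{L_x,L_z\to\infty}\frac{\eta}{8\,\mathsf{R}_{\mathsf{rad}}}\frac{\Psi}{4\pi}\iint_{\tilde{\mathcal{H}}}f_3\,dx\,dz.$$ All parameters other than those tending to infinity are fixed in these limits. With $\mu_{\mathsf{oc}}=A/d^2$, the values of these limits are $\mathsf{G}_{\mathsf{eva}}^{\mathsf{upa}}=\frac{\eta\mu_{\mathsf{oc}}}{8\mathsf{R}_{\mathsf{rad}}}\big(\frac12-\frac{\lambda^2}{24\pi^2r^2\Psi^2}+\frac{\lambda^4}{160\pi^4r^4\Psi^4}\big)$ and $\mathsf{G}_{\mathsf{rad}}^{\mathsf{upa}}=\frac{\eta\mu_{\mathsf{oc}}}{8\mathsf{R}_{\mathsf{rad}}}\cdot\frac12$, and the continuous-aperture values are the same with $\mu_{\mathsf{oc}}$ replaced by $1$. *)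

(* Defs.v *)
From HB Require Import structures.
From mathcomp Require Import all_boot all_order all_algebra.
From mathcomp Require Import all_classical all_reals all_analysis.

Set Implicit Arguments.
Unset Strict Implicit.
Unset Printing Implicit Defensive.

Import Order.TTheory GRing.Theory Num.Theory.
Import numFieldNormedType.Exports.

Local Open Scope classical_set_scope.
Local Open Scope ring_scope.

Definition dirPhi (R : realType) (phi theta : R) : R := cos phi * sin theta.
Definition dirPsi (R : realType) (phi theta : R) : R := sin phi * sin theta.
Definition dirTheta (R : realType) (theta : R) : R := cos theta.

Definition wavenumber (R : realType) (lambda : R) : R := 2 * pi / lambda.

Definition eta (R : realType) : R := 120 * pi.

Definition f (R : realType) (n : nat) (phi theta : R) (p : R * R) : R :=
  ((p.1 - dirPhi phi theta) ^+ 2 + dirPsi phi theta ^+ 2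
   + (p.2 - dirTheta theta) ^+ 2) `^ (- (n%:R / 2)).

(* kernel with the reactive terms; [f 3] is the kernel without them *)
Definition F (R : realType) (r lambda phi theta : R) (p : R * R) : R :=
  f 3 phi theta p
  - 1 / (wavenumber lambda ^+ 2 * r ^+ 2) * f 5 phi theta p
  + 1 / (wavenumber lambda ^+ 4 * r ^+ 4) * f 7 phi theta p.

(* integral over [-a, a] x [-b, b] against planar Lebesgue measure *)
Definition rect_integral (R : realType) (a b : R) (g : R * R -> R) : R :=
  \int[(@lebesgue_measure R \x @lebesgue_measure R)%E]_(p in
    `[- a, a]%classic `*` `[- b, b]%classic) g p.

(* M = (M_x, M_z) is the pair of numbers of elements along the two axes *)
Definition discrete_gain (R : realType) (r phi theta A d Rrad : R)
    (g : R * R -> R) (M : nat * nat) : R :=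
  eta R / (8 * Rrad) * (A * dirPsi phi theta / (4 * pi * d ^+ 2))
  * rect_integral (M.1%:R * (d / r) / 2) (M.2%:R * (d / r) / 2) g.

(* L = (L_x, L_z) is the pair of side lengths of the aperture *)
Definition continuous_gain (R : realType) (r phi theta Rrad : R)
    (g : R * R -> R) (L : R * R) : R :=
  eta R / (8 * Rrad) * (dirPsi phi theta / (4 * pi))
  * rect_integral (L.1 / (2 * r)) (L.2 / (2 * r)) g.

(* M_x and M_z tend to infinity jointly and independently, through odd values *)
Definition odd_pairs_to_infinity : set_system (nat * nat) :=
  within [set M : nat * nat | odd M.1 /\ odd M.2] (filter_prod \oo \oo).

(* L_x and L_z tend to infinity jointly and independently; positivity of the
   lengths holds eventually along this filter *)
Definition real_pairs_to_infinity (R : realType) : set_system (R * R) :=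
  filter_prod (pinfty_nbhs R) (pinfty_nbhs R).
Arguments real_pairs_to_infinity R : clear implicits.

Definition G_eva (R : realType) (r phi theta lambda A d Rrad : R) : R :=
  lim (discrete_gain r phi theta A d Rrad (F r lambda phi theta)
       @ odd_pairs_to_infinity).

Definition G_rad (R : realType) (r phi theta A d Rrad : R) : R :=
  lim (discrete_gain r phi theta A d Rrad (f 3 phi theta)
       @ odd_pairs_to_infinity).

Definition Gt_eva (R : realType) (r phi theta lambda Rrad : R) : R :=
  lim (continuous_gain r phi theta Rrad (F r lambda phi theta)
       @ real_pairs_to_infinity R).

Definition Gt_rad (R : realType) (r phi theta Rrad : R) : R :=
  lim (continuous_gain r phi theta Rrad (f 3 phi theta)
       @ real_pairs_to_infinity R).

(* [lim] takes a junk value on a divergent filter; this states that the four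
   limits above are genuine *)
Definition gains_exist (R : realType) (r phi theta lambda A d Rrad : R) :=
  [/\ discrete_gain r phi theta A d Rrad (F r lambda phi theta)
        @ odd_pairs_to_infinity --> G_eva r phi theta lambda A d Rrad,
      discrete_gain r phi theta A d Rrad (f 3 phi theta)
        @ odd_pairs_to_infinity --> G_rad r phi theta A d Rrad,
      continuous_gain r phi theta Rrad (F r lambda phi theta)
        @ real_pairs_to_infinity R --> Gt_eva r phi theta lambda Rrad
    & continuous_gain r phi theta Rrad (f 3 phi theta)
        @ real_pairs_to_infinity R --> Gt_rad r phi theta Rrad].

(* Main.v *)
Require Import Defs.
From mathcomp Require Import all_boot all_order all_algebra.
From mathcomp Require Import all_classical all_reals all_analysis.
From mathcomp Require Import measurable_realfun ring lra.
Import Order.TTheory GRing.Theory Num.Theory.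
Import numFieldNormedType.Exports.
Local Open Scope classical_set_scope.
Local Open Scope ring_scope.

(** The kernels f_n are nonnegative, so growing rectangles exhaust their integral over the
    whole plane, however the two sides tend to infinity.  By Tonelli this integral is
    iterated.  With q = (z - Theta)^2 + Psi^2, the substitution t = x / sqrt (x^2 + q) has
    dt = q (x^2 + q)^(-3/2) dx and 1 - t^2 = q / (x^2 + q), which turns the inner integrand
    into the polynomial (1 - t^2)^((n - 3)/2) / q^((n - 1)/2) on ]-1, 1[.  What remains is
    the integral of an integer power of 1 / (z^2 + Psi^2), an arctangent plus a rational
    function.  The total is 2 pi / ((n - 2) Psi^(n - 2)), and the ratio of the gains follows
    by linearity.  With y = lambda^2 / (pi r Psi)^2 it is 1 - y/12 + y^2/80, which is below
    1 exactly when y < 20/3. *)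

(** * One-dimensional integrals *)

(** Translation removes [a], evenness folds the line onto twice the half-line, and the fundamental
    theorem of calculus leaves [l - G 0]. The shift is kept because the kernels are centred at Phi
    and Theta. *)
Lemma integralT_even_antiderivative (R : realType) (g G : R -> R) (a l : R) :
  (forall x, 0 <= g x) -> (forall x, g (- x) = g x) -> continuous g ->
  (forall x : R, is_derive x 1 G (g x)) -> G 0 = 0 -> G x @[x --> +oo] --> l ->
  (\int[@lebesgue_measure R]_x (g (x - a))%:E = (2 * l)%:E)%E.
Proof.
move=> g0 geven cg dG G0 Gl.
have d1 : (fun x : R => x - a)^`()%classic = cst 1.
  by apply/funext => x; rewrite derive1E derive_val subr0.
transitivity (\int[@lebesgue_measure R]_x (g x)%:E)%E.
  rewrite [RHS](@increasing_ge0_integration_by_substitutionT R (fun x => x - a) g) //=.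
  - by apply: eq_integral => x _; rewrite d1 /GRing.mul/= mulr1.
  - by move=> x y xy; rewrite ltrD2r.
  - by rewrite d1; exact: cst_continuous.
  - by rewrite d1; exact: is_cvg_cst.
  - by rewrite d1; exact: is_cvg_cst.
  - by have := cvg_addrr_Ny (- a).
  - exact: cvg_addrr.
rewrite ge0_symfun_integralT //; last by move=> x /=; rewrite geven.
rewrite -set_itvcy (@ge0_continuous_FTC2y _ g G 0 l) //.
- by rewrite G0 -EFinB subr0 -EFinM.
- exact: continuous_subspaceT.
- apply: cvg_at_right_filter.
  exact/differentiable_continuous/derivable1_diffP/ex_derive.
- by move=> x _; rewrite derive1E derive_val.
Qed.

Lemma is_derive_div_sqrt (R : realType) (q x : R) : 0 < q ->
  is_derive x 1 (fun x => x / Num.sqrt (x ^+ 2 + q))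
    (q * Num.sqrt (x ^+ 2 + q) ^- 3).
Proof.
move=> q0.
have S0 : 0 < x ^+ 2 + q by rewrite ltr_wpDl ?sqr_ge0.
have s0 : 0 < Num.sqrt (x ^+ 2 + q) by rewrite sqrtr_gt0.
have sE : Num.sqrt (x ^+ 2 + q) ^+ 2 = x ^+ 2 + q by rewrite sqr_sqrtr ?ltW.
have s_neq0 : Num.sqrt (x ^+ 2 + q) != 0 by rewrite gt_eqF.
have dS : is_derive x 1 (fun x => Num.sqrt (x ^+ 2 + q)) (x / Num.sqrt (x ^+ 2 + q)).
  have dq : is_derive x 1 (fun x => x ^+ 2 + q) (2 * x).
    by apply: is_derive_eq; rewrite /GRing.scale/=; ring.
  have := @is_derive1_comp R Num.sqrt (fun x => x ^+ 2 + q) x _ _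
    (is_derive1_sqrt S0) dq.
  by congr is_derive; field.
have dV := @is_deriveV R (fun x => Num.sqrt (x ^+ 2 + q)) x _ _ s_neq0 dS.
apply: is_derive_eq.
rewrite /GRing.scale/=.
move: sE s_neq0; set s := Num.sqrt _ => sE sn.
(* Eliminating [q] leaves a rational identity in [s] and [x]. *)
have -> : q = s ^+ 2 - x ^+ 2 by rewrite sE; ring.
by field.
Qed.

Lemma cvgy_div_sqrt (R : realType) (q : R) : 0 < q ->
  x / Num.sqrt (x ^+ 2 + q) @[x --> +oo] --> (1 : R).
Proof.
move=> q0.
(* The lower bound 1 - q / x <= x / s amounts to (s - x) x <= q s, which follows from q = (s - x)(s
   + x) and s >= x > 1. *)
have h : (1 - q / x : R) @[x --> +oo] --> (1 : R).
  rewrite -[X in _ --> X]subr0; apply: cvgB; first exact: cvg_cst.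
  rewrite -[X in _ --> X](mulr0 q); apply: cvgM; first exact: cvg_cst.
  by apply/gtr0_cvgV0; [exact: nbhs_pinfty_gt | exact: cvg_id].
apply: (squeeze_cvgr _ h (cvg_cst (1 : R))).
near=> x.
have x0 : 1 < x by near: x; exact: nbhs_pinfty_gt.
have s0 : 0 < Num.sqrt (x ^+ 2 + q) by rewrite sqrtr_gt0 ltr_wpDl ?sqr_ge0.
have sE : Num.sqrt (x ^+ 2 + q) ^+ 2 = x ^+ 2 + q.
  by rewrite sqr_sqrtr// addr_ge0 ?sqr_ge0 ?ltW.
move: s0 sE; set s := Num.sqrt _ => s0 sE.
have xs : x <= s by nra.
rewrite ler_pdivrMr// mul1r xs andbT.
rewrite ler_pdivlMr//.
have -> : (1 - q / x) * s = s - q * s / x by field; lra.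
rewrite lerBlDr -lerBlDl ler_pdivlMr; last lra.
nra.
Unshelve. all: end_near. Qed.

Lemma cvgy_div_sqr (R : realType) (q : R) k : 0 < q ->
  x / (x ^+ 2 + q) ^+ k.+1 @[x --> +oo] --> (0 : R).
Proof.
move=> q0.
have h : x^-1 @[x --> +oo] --> (0 : R).
  by apply/gtr0_cvgV0; [exact: nbhs_pinfty_gt | exact: cvg_id].
apply: (squeeze_cvgr _ (cvg_cst (0 : R)) h).
near=> x.
have x1 : 1 < x by near: x; exact: nbhs_pinfty_gt.
have S0 : 1 <= x ^+ 2 + q by nra.
have Sk : 1 <= (x ^+ 2 + q) ^+ k by rewrite exprn_ege1.
rewrite divr_ge0 /=; [|lra|rewrite exprn_ge0//; lra].
rewrite ler_pdivrMr ?exprn_gt0//; last lra.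
rewrite exprS ler_pdivlMl; last lra.
nra.
Unshelve. all: end_near. Qed.

(** With S = x^2 + q the derivative is S^(-k) - 2 k x^2 S^(-k-1); putting x^2 = S - q leaves two
    consecutive powers of 1 / S, a reduction formula for the outer integrals. *)
Lemma is_derive_div_sqr (R : realType) (q x : R) k : 0 < q ->
  is_derive x 1 (fun x => x / (x ^+ 2 + q) ^+ k)
    ((2 * k%:R * q) * (x ^+ 2 + q) ^- k.+1
      - (2 * k%:R - 1) * (x ^+ 2 + q) ^- k).
Proof.
move=> q0.
have S0 : x ^+ 2 + q != 0 by rewrite gt_eqF// ltr_wpDl ?sqr_ge0.
have Sk0 : (x ^+ 2 + q) ^+ k != 0 by rewrite expf_neq0.
have dq : is_derive x 1 (fun x => x ^+ 2 + q) (2 * x).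
  by apply: is_derive_eq; rewrite /GRing.scale/=; ring.
have dS : is_derive x 1 (fun x => (x ^+ 2 + q) ^+ k)
    (k%:R * (x ^+ 2 + q) ^+ k.-1 * (2 * x)).
  have -> : (fun x => (x ^+ 2 + q) ^+ k) = (fun x : R => x ^+ 2 + q) ^+ k.
    by apply/funext => y; rewrite exprfctE.
  by apply: is_derive_eq; rewrite /GRing.scale/=; ring.
have dV := @is_deriveV R (fun x => (x ^+ 2 + q) ^+ k) x _ _ Sk0 dS.
apply: is_derive_eq.
(* The power rule produces the exponent [k.-1], truncated at [k = 0], so that case is checked
   apart. *)
rewrite /GRing.scale/=; move: Sk0 S0 {dq dS dV}; case: k => [|k] Sk0 S0.
  by rewrite !mul0r !expr0; field.
have [s sE] : {s | s = x ^+ 2 + q} by exists (x ^+ 2 + q).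
rewrite -!sE /= !exprS -natr1 in S0 *; have -> : q = s - x * x by rewrite sE; ring.
have T0 : s ^+ k != 0 by rewrite expf_neq0.
by field; rewrite S0 T0.
Qed.

Lemma is_derive_atan_div (R : realType) (c x : R) : 0 < c ->
  is_derive x 1 (fun x => atan (x / c) / c) (x ^+ 2 + c ^+ 2)^-1.
Proof.
move=> c0.
have S0 : 0 < x ^+ 2 + c ^+ 2 by rewrite ltr_wpDl ?sqr_ge0 ?exprn_gt0.
have c_neq0 : c != 0 by rewrite gt_eqF.
have dq : is_derive x 1 (fun x => x / c) (c^-1).
  by apply: is_derive_eq; rewrite /GRing.scale/=; ring.
have dA := @is_derive1_comp R (@atan R) (fun x => x / c) x _ _ (is_derive1_atan _) dq.
have dA' : is_derive x 1 (fun x => atan (x / c)) ((1 + (x / c) ^+ 2)^-1 * c^-1).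
  exact: dA.
apply: is_derive_eq.
rewrite /GRing.scale/=; field.
by rewrite c_neq0 gt_eqF.
Qed.

Lemma cvgy_atan_div (R : realType) (c : R) : 0 < c ->
  atan (x / c) / c @[x --> +oo] --> (pi / 2 / c : R).
Proof.
move=> c0; apply: cvgM; last exact: cvg_cst.
apply: (cvg_comp (fun x => x / c) (@atan R) _ (@cvgy_atan R)).
by apply: gt0_cvgMly; [rewrite invr_gt0 | exact: cvg_id].
Qed.

Lemma continuous_sqrD (R : realType) (q : R) :
  continuous (fun x : R => x ^+ 2 + q).
Proof. by move=> x; apply: cvgD; [exact: exprn_continuous | exact: cvg_cst]. Qed.

Lemma continuous_exprVn (R : realType) (h : R -> R) (n : nat) :
  continuous h -> (forall x, 0 < h x) -> continuous (fun x => h x ^- n).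
Proof.
move=> ch h0 x; apply: cvgV; first by rewrite expf_neq0// gt_eqF.
apply: (continuous_cvg _ (h := fun y : R => y ^+ n)); first exact: exprn_continuous.
exact: ch.
Qed.

(** [P] is a primitive in the variable t = x / s. By the chain rule [P (x / s)] has derivative
    [dP (x / s) * (q * s ^- 3)], which the last hypothesis identifies with the integrand, and t
    tends to 1 at infinity. *)
Lemma integralT_sqrt_sqrD (R : realType) (n : nat) (q a : R) (P dP : R -> R) :
  0 < q -> P 0 = 0 -> (forall t : R, is_derive t 1 P (dP t)) ->
  (forall x, let s := Num.sqrt (x ^+ 2 + q) in
    dP (x / s) * (q * s ^- 3) = s ^- n) ->
  (\int[@lebesgue_measure R]_x (Num.sqrt ((x - a) ^+ 2 + q) ^- n)%:E =
    (2 * P 1)%:E)%E.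
Proof.
move=> q0 P0 dPE PE.
apply: (@integralT_even_antiderivative R (fun x => Num.sqrt (x ^+ 2 + q) ^- n)
  (fun x => P (x / Num.sqrt (x ^+ 2 + q)))).
- by move=> x; rewrite invr_ge0 exprn_ge0.
- by move=> x; rewrite sqrrN.
- apply: continuous_exprVn => x; last by rewrite sqrtr_gt0 ltr_wpDl ?sqr_ge0.
  apply: (continuous_cvg _ (h := @Num.sqrt R)); first exact: sqrt_continuous.
  exact: continuous_sqrD.
- move=> x.
  have := @is_derive1_comp R P _ x _ _ (dPE _) (is_derive_div_sqrt _ _ x q0).
  by rewrite PE.
- by rewrite mul0r.
- apply: continuous_cvg; last exact: cvgy_div_sqrt.
  exact/differentiable_continuous/derivable1_diffP/ex_derive.
Qed.

Lemma integralT_sqrt_sqrD3 (R : realType) (q a : R) : 0 < q ->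
  (\int[@lebesgue_measure R]_x (Num.sqrt ((x - a) ^+ 2 + q) ^- 3)%:E =
    (2 / q)%:E)%E.
Proof.
move=> q0.
have dP (t : R) : is_derive t 1 (fun t => t / q) (q^-1).
  by apply: is_derive_eq; rewrite /GRing.scale/=; ring.
rewrite (@integralT_sqrt_sqrD R 3 q a _ _ q0 _ dP)//.
- by rewrite mul1r.
- by rewrite mul0r.
- move=> x /=.
  have s0 : Num.sqrt (x ^+ 2 + q) != 0.
    by rewrite gt_eqF// sqrtr_gt0 ltr_wpDl ?sqr_ge0.
  by field; rewrite s0 gt_eqF.
Qed.

Lemma integralT_sqrt_sqrD5 (R : realType) (q a : R) : 0 < q ->
  (\int[@lebesgue_measure R]_x (Num.sqrt ((x - a) ^+ 2 + q) ^- 5)%:E =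
    (4 / 3 / q ^+ 2)%:E)%E.
Proof.
move=> q0.
(* The substitution at n = 5 gives (1 - t^2) / q^2, whose primitive is (1 - 1/3) / q^2 at t = 1. *)
have dP (t : R) : is_derive t 1 (fun t => (t - t ^+ 3 / 3) / q ^+ 2) ((1 - t ^+ 2) / q ^+ 2).
  by apply: is_derive_eq; rewrite /GRing.scale/=; field; rewrite gt_eqF.
rewrite (@integralT_sqrt_sqrD R 5 q a _ _ q0 _ dP)//.
- by congr EFin; field; rewrite gt_eqF.
- by rewrite expr0n /= mul0r subr0 mul0r.
- move=> x /=.
  have s0 : Num.sqrt (x ^+ 2 + q) != 0.
    by rewrite gt_eqF// sqrtr_gt0 ltr_wpDl ?sqr_ge0.
  have : Num.sqrt (x ^+ 2 + q) ^+ 2 = x ^+ 2 + q.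
    by rewrite sqr_sqrtr// addr_ge0 ?sqr_ge0 ?ltW.
  move: s0; set s := Num.sqrt _ => s0 sE.
  (* [q0] is rewritten along with the goal, so that it yields the nonvanishing of the denominator
     s^2 - x^2. *)
  have := q0; have -> : q = s ^+ 2 - x ^+ 2 by rewrite sE; ring.
  by move=> h0; field; rewrite s0 gt_eqF.
Qed.

Lemma integralT_sqrt_sqrD7 (R : realType) (q a : R) : 0 < q ->
  (\int[@lebesgue_measure R]_x (Num.sqrt ((x - a) ^+ 2 + q) ^- 7)%:E =
    (16 / 15 / q ^+ 3)%:E)%E.
Proof.
move=> q0.
(* At n = 7 the integrand is (1 - t^2)^2 / q^3, and the primitive is (1 - 2/3 + 1/5) / q^3 = (8/15)
   / q^3 at t = 1. *)
have dP (t : R) : is_derive t 1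
    (fun t => (t - 2 / 3 * t ^+ 3 + t ^+ 5 / 5) / q ^+ 3) ((1 - t ^+ 2) ^+ 2 / q ^+ 3).
  by apply: is_derive_eq; rewrite /GRing.scale/=; field; rewrite gt_eqF.
rewrite (@integralT_sqrt_sqrD R 7 q a _ _ q0 _ dP)//.
- by congr EFin; field; rewrite gt_eqF.
- by rewrite !expr0n /= mulr0 mul0r subr0 addr0 mul0r.
- move=> x /=.
  have s0 : Num.sqrt (x ^+ 2 + q) != 0.
    by rewrite gt_eqF// sqrtr_gt0 ltr_wpDl ?sqr_ge0.
  have : Num.sqrt (x ^+ 2 + q) ^+ 2 = x ^+ 2 + q.
    by rewrite sqr_sqrtr// addr_ge0 ?sqr_ge0 ?ltW.
  move: s0; set s := Num.sqrt _ => s0 sE.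
  have := q0; have -> : q = s ^+ 2 - x ^+ 2 by rewrite sE; ring.
  by move=> h0; field; rewrite s0 gt_eqF.
Qed.

Lemma integralT_sqrD_exprN (R : realType) (c b l : R) (k : nat) (G : R -> R) :
  0 < c -> (forall x : R, is_derive x 1 G ((x ^+ 2 + c ^+ 2) ^- k)) ->
  G 0 = 0 -> G x @[x --> +oo] --> l ->
  (\int[@lebesgue_measure R]_x (((x - b) ^+ 2 + c ^+ 2) ^- k)%:E = (2 * l)%:E)%E.
Proof.
move=> c0 dG G0 Gl.
have S0 (x : R) : 0 < x ^+ 2 + c ^+ 2 by rewrite ltr_wpDl ?sqr_ge0 ?exprn_gt0.
apply: (@integralT_even_antiderivative R (fun x => (x ^+ 2 + c ^+ 2) ^- k) G) => //.
- by move=> x; rewrite invr_ge0 exprn_ge0// ltW.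
- by move=> x; rewrite sqrrN.
- by apply: continuous_exprVn => // x; exact: continuous_sqrD.
Qed.

Lemma integralT_sqrD_exprN1 (R : realType) (c b : R) : 0 < c ->
  (\int[@lebesgue_measure R]_x (((x - b) ^+ 2 + c ^+ 2) ^- 1)%:E =
    (pi / c)%:E)%E.
Proof.
move=> c0.
rewrite (integralT_sqrD_exprN R c b _ 1 _ c0
  (fun x => is_derive_atan_div _ c x c0) _ (cvgy_atan_div _ _ c0)).
- by congr EFin; field; rewrite gt_eqF.
- by rewrite mul0r atan0 mul0r.
Qed.

(* The antiderivatives come from integrating the derivative of
   x / (x^2 + c^2)^k, which lowers the exponent by one. *)
Lemma integralT_sqrD_exprN2 (R : realType) (c b : R) : 0 < c ->
  (\int[@lebesgue_measure R]_x (((x - b) ^+ 2 + c ^+ 2) ^- 2)%:E =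
    (pi / (2 * c ^+ 3))%:E)%E.
Proof.
move=> c0.
have c20 : 0 < c ^+ 2 by rewrite exprn_gt0.
pose G (x : R) := (2 * c ^+ 2)^-1 * (x / (x ^+ 2 + c ^+ 2) ^+ 1 + atan (x / c) / c).
have dG (x : R) : is_derive x 1 G ((x ^+ 2 + c ^+ 2) ^- 2).
  have d1 := is_derive_div_sqr _ _ x 1 c20; have d2 := is_derive_atan_div _ _ x c0.
  apply: is_derive_eq; rewrite /GRing.scale/=.
  by field; rewrite !gt_eqF// ltr_wpDl ?sqr_ge0.
rewrite (@integralT_sqrD_exprN R c b ((2 * c ^+ 2)^-1 * (0 + pi / 2 / c)) 2 G c0 dG).
- by congr EFin; field; rewrite gt_eqF.
- by rewrite /G !mul0r atan0 mul0r addr0 mulr0.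
- apply: cvgM; first exact: cvg_cst.
  by apply: cvgD; [exact: cvgy_div_sqr | exact: cvgy_atan_div].
Qed.

Lemma integralT_sqrD_exprN3 (R : realType) (c b : R) : 0 < c ->
  (\int[@lebesgue_measure R]_x (((x - b) ^+ 2 + c ^+ 2) ^- 3)%:E =
    (3 * pi / (8 * c ^+ 5))%:E)%E.
Proof.
move=> c0.
have c20 : 0 < c ^+ 2 by rewrite exprn_gt0.
(* With S = x^2 + c^2, [is_derive_div_sqr] at [k = 2] reads (x / S^2)' = 4 c^2 S^(-3) - 3 S^(-2).
   Solving for S^(-3) gives [G], the factor after 3 being the antiderivative of S^(-2). *)
pose G (x : R) := (4 * c ^+ 2)^-1 * (x / (x ^+ 2 + c ^+ 2) ^+ 2 +
  3 * ((2 * c ^+ 2)^-1 * (x / (x ^+ 2 + c ^+ 2) ^+ 1 + atan (x / c) / c))).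
have dG (x : R) : is_derive x 1 G ((x ^+ 2 + c ^+ 2) ^- 3).
  have d1 := is_derive_div_sqr _ _ x 1 c20; have d2 := is_derive_atan_div _ _ x c0.
  have d3 := is_derive_div_sqr _ _ x 2 c20.
  apply: is_derive_eq; rewrite /GRing.scale/=.
  by field; rewrite !gt_eqF// ltr_wpDl ?sqr_ge0.
rewrite (@integralT_sqrD_exprN R c b
  ((4 * c ^+ 2)^-1 * (0 + 3 * ((2 * c ^+ 2)^-1 * (0 + pi / 2 / c)))) 3 G c0 dG).
- by congr EFin; field; rewrite gt_eqF.
- by rewrite /G !mul0r atan0 mul0r !(mulr0, addr0).
- apply: cvgM; first exact: cvg_cst.
  apply: cvgD; first exact: cvgy_div_sqr.
  apply: cvgM; first exact: cvg_cst.
  apply: cvgM; first exact: cvg_cst.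
  by apply: cvgD; [exact: cvgy_div_sqr | exact: cvgy_atan_div].
Qed.

(** * Integrals over the plane and over growing rectangles *)

(** Trades the real exponent -n/2 for an integer power of a square root, and groups Psi^2 with the z
    term, which together form the constant q of the integral in x. *)
Lemma f_sqrt (R : realType) (n : nat) (phi theta : R) (p : R * R) :
  f n phi theta p =
  Num.sqrt ((p.1 - dirPhi phi theta) ^+ 2
    + ((p.2 - dirTheta theta) ^+ 2 + dirPsi phi theta ^+ 2)) ^- n.
Proof.
rewrite /f powRN mulrC powRrM powR12_sqrt ?powR_mulrn ?sqrtr_ge0//.
  by rewrite -addrA [in X in _ + X]addrC.
by rewrite !addr_ge0 ?sqr_ge0.
Qed.

Lemma f_ge0 (R : realType) (n : nat) (phi theta : R) (p : R * R) :
  0 <= f n phi theta p.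
Proof. exact: powR_ge0. Qed.

Lemma measurable_f (R : realType) (n : nat) (phi theta : R) :
  measurable_fun [set: R * R] (f n phi theta).
Proof.
have mq : measurable_fun [set: R * R] (fun p => (p.1 - dirPhi phi theta) ^+ 2
    + dirPsi phi theta ^+ 2 + (p.2 - dirTheta theta) ^+ 2).
  apply: measurable_funD; last by apply: measurable_funX; exact: measurable_funB.
  by apply: measurable_funD => //; apply: measurable_funX; exact: measurable_funB.
exact: (measurableT_comp (measurable_powR (- (n%:R / 2))) mq).
Qed.

(** Tonelli, with x integrated first. At fixed z the constant q = (z - Theta)^2 + Psi^2 is positive
    because Psi is nonzero; the inner integral K / q^k does not depend on the centre Phi, and
    [outer] at Theta finishes. *)
Lemma plane_integral_f (R : realType) (n k : nat) (phi theta K l : R) :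
  dirPsi phi theta != 0 -> 0 <= K ->
  (forall q a : R, 0 < q ->
    (\int[@lebesgue_measure R]_x (Num.sqrt ((x - a) ^+ 2 + q) ^- n)%:E
      = (K / q ^+ k)%:E)%E) ->
  (forall b : R,
    (\int[@lebesgue_measure R]_x
      (((x - b) ^+ 2 + dirPsi phi theta ^+ 2) ^- k)%:E = l%:E)%E) ->
  (\int[(@lebesgue_measure R \x @lebesgue_measure R)%E]_p (f n phi theta p)%:E
    = (K * l)%:E)%E.
Proof.
move=> Psi0 K0 inner outer.
rewrite fubini_tonelli2; last 2 first.
- have mE : measurable_fun [set: R * R] (EFin \o f n phi theta).
    by apply/measurable_EFinP; exact: measurable_f.
  exact: mE.
- by move=> p; rewrite lee_fin f_ge0.
rewrite EFinM -(outer (dirTheta theta)) -ge0_integralZl_EFin//.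
- apply: eq_integral => y _; rewrite /fubini_G /=.
  under eq_integral do rewrite f_sqrt /=.
  rewrite inner ?EFinM//.
  by rewrite ltr_wpDl ?sqr_ge0// lt0r sqrf_eq0 Psi0 sqr_ge0.
- by move=> y _; rewrite lee_fin invr_ge0 exprn_ge0// addr_ge0 ?sqr_ge0.
- apply/measurable_EFinP; apply: continuous_measurable_fun.
  apply: continuous_exprVn => y; last first.
    by rewrite ltr_wpDl ?sqr_ge0// lt0r sqrf_eq0 Psi0 sqr_ge0.
  apply: (continuous_cvg _ (h := fun z : R => z ^+ 2 + dirPsi phi theta ^+ 2)).
    exact: continuous_sqrD.
  by apply: cvgB; [exact: cvg_id | exact: cvg_cst].
Qed.

(** Monotone convergence along the squares [-n, n]^2 gives the limit of a sequence; monotonicity in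
    the rectangle then extends it to both sides growing independently. *)
Lemma rect_integral_cvg (R : realType) (g : R * R -> R) (l : R) :
  measurable_fun [set: R * R] g -> (forall p, 0 <= g p) ->
  (\int[(@lebesgue_measure R \x @lebesgue_measure R)%E]_p (g p)%:E = l%:E)%E ->
  rect_integral L.1 L.2 g @[L --> real_pairs_to_infinity R] --> l.
Proof.
move=> mg g0 gl.
pose rect (a b : R) : set (R * R) := `[- a, a]%classic `*` `[- b, b]%classic.
have mrect a b : measurable (rect a b) by exact: measurableX.
have sub_rect a a' b b' : a <= a' -> b <= b' -> rect a b `<=` rect a' b'.
  move=> aa bb p [] /=; rewrite !in_itv /= => /andP[h1 h2] /andP[h3 h4].
  split; rewrite /= in_itv /=; apply/andP; split; lra.
pose I (A : set (R * R)) :=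
  (\int[(@lebesgue_measure R \x @lebesgue_measure R)%E]_(p in A) (g p)%:E)%E.
have I_le (A B : set (R * R)) : measurable A -> measurable B -> A `<=` B ->
    (I A <= I B)%E.
  move=> mA mB AB; apply: ge0_subset_integral => //.
  - by apply/measurable_EFinP; exact: measurable_funTS.
  - by move=> p _; rewrite lee_fin.
have cover : \bigcup_n rect n%:R n%:R = [set: R * R].
  apply/seteqP; split => // p _.
  exists (Num.bound (`|p.1| + `|p.2|)) => //.
  have h := archi_boundP (addr_ge0 (normr_ge0 p.1) (normr_ge0 p.2)).
  have h1 := normr_ge0 p.1; have h2 := normr_ge0 p.2.
  by split; rewrite /= in_itv /= -ler_norml; apply/ltW/(le_lt_trans _ h); lra.
have Icvg : I (rect n%:R n%:R) @[n --> \oo] --> l%:E.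
  rewrite -gl -cover; apply: ge0_nondecreasing_set_cvg_integral.
  - move=> n m nm; apply/subsetPset; apply: sub_rect; rewrite ler_nat//.
  - by move=> n; exact: mrect.
  - by move=> n; apply/measurable_EFinP; exact: measurable_funTS.
  - by move=> n p _; rewrite lee_fin.
have IleT a b : (I (rect a b) <= l%:E)%E by rewrite -gl; exact: I_le.
(* [rect_integral] is the [fine] part of an extended integral, with default value 0 at infinity; the
   bound by [l] excludes that case. *)
have I_fin a b : I (rect a b) = (rect_integral a b g)%:E.
  rewrite /rect_integral /Rintegral fineK//.
  rewrite ge0_fin_numE; last by apply: integral_ge0 => p _; rewrite lee_fin.
  exact: (le_lt_trans (IleT a b) (ltry _)).
have rcvg : (rect_integral n%:R n%:R g : R) @[n --> \oo] --> l.
  rewrite [X in X @ _](_ : _ = fine \o (fun n => I (rect n%:R n%:R))).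
    exact: fine_cvg.
  by apply/funext => n; rewrite /= I_fin.
apply/cvgrPdist_lt => e e0.
have /cvgrPdist_lt/(_ e e0)[N _ hN] := rcvg.
(* A rectangle with half-sides at least [N] contains the square of half-side [N], so its integral
   lies between that of the square and [l]. *)
exists ([set x | N%:R <= x], [set x | N%:R <= x]).
  by split; exact: nbhs_pinfty_ge.
move=> [a b] [/= Na Nb].
have := hN N (leqnn N); rewrite /=.
have h1 : rect_integral N%:R N%:R g <= rect_integral a b g.
  by rewrite -lee_fin -!I_fin; apply: I_le => //; exact: sub_rect.
have h2 : rect_integral a b g <= l by rewrite -lee_fin -I_fin.
rewrite !ger0_norm; lra.
Qed.

Lemma Rintegral_lincomb3 (d : measure_display) (T : measurableType d)
    (R : realType) (mu : {measure set T -> \bar R}) (D : set T)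
    (g1 g2 g3 : T -> R) (a b : R) :
  measurable D -> mu.-integrable D (EFin \o g1) ->
  mu.-integrable D (EFin \o g2) -> mu.-integrable D (EFin \o g3) ->
  \int[mu]_(x in D) (g1 x - a * g2 x + b * g3 x) =
  \int[mu]_(x in D) g1 x - a * \int[mu]_(x in D) g2 x
    + b * \int[mu]_(x in D) g3 x.
Proof.
move=> mD i1 i2 i3.
have iZ c g : mu.-integrable D (EFin \o g) ->
    mu.-integrable D (EFin \o (fun x => c * g x)).
  move=> i; have := integrableZl mD c i; exact: eq_integrable.
have iB : mu.-integrable D (EFin \o (fun x => g1 x - a * g2 x)).
  have := integrableB mD i1 (iZ a _ i2).
  exact: eq_integrable.
rewrite (RintegralD mD iB (iZ b _ i3)) (RintegralB mD i1 (iZ a _ i2)).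
by rewrite (RintegralZl _ mD i2) (RintegralZl _ mD i3).
Qed.

(** For a nonnegative kernel a finite plane integral is integrability. It serves to split the
    integral of [F] by linearity. *)
Lemma integrable_f (R : realType) (n : nat) (phi theta l : R) (D : set (R * R)) :
  measurable D ->
  (\int[(@lebesgue_measure R \x @lebesgue_measure R)%E]_p (f n phi theta p)%:E
    = l%:E)%E ->
  (@lebesgue_measure R \x @lebesgue_measure R)%E.-integrable D
    (EFin \o f n phi theta).
Proof.
move=> mD fl.
have mE : measurable_fun [set: R * R] (EFin \o f n phi theta).
  by apply/measurable_EFinP; exact: measurable_f.
apply: (@integrableS _ _ _ _ setT) => //; apply/integrableP; split => //.
under eq_integral do rewrite /= ger0_norm ?f_ge0//.
by rewrite fl ltry.
Qed.

Lemma plane_integral_f3 (R : realType) (phi theta : R) :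
  0 < dirPsi phi theta ->
  (\int[(@lebesgue_measure R \x @lebesgue_measure R)%E]_p (f 3 phi theta p)%:E
    = (2 * pi / dirPsi phi theta)%:E)%E.
Proof.
move=> P0; have Pn : dirPsi phi theta != 0 by rewrite gt_eqF.
rewrite (@plane_integral_f R 3 1 phi theta 2 (pi / dirPsi phi theta))//.
- by rewrite mulrA.
- by move=> q a q0; rewrite integralT_sqrt_sqrD3.
- by move=> b; rewrite integralT_sqrD_exprN1.
Qed.

Lemma plane_integral_f5 (R : realType) (phi theta : R) :
  0 < dirPsi phi theta ->
  (\int[(@lebesgue_measure R \x @lebesgue_measure R)%E]_p (f 5 phi theta p)%:E
    = (2 * pi / (3 * dirPsi phi theta ^+ 3))%:E)%E.
Proof.
move=> P0; have Pn : dirPsi phi theta != 0 by rewrite gt_eqF.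
rewrite (@plane_integral_f R 5 2 phi theta (4 / 3) (pi / (2 * dirPsi phi theta ^+ 3)))//.
- by congr EFin; field.
- by move=> q a q0; rewrite integralT_sqrt_sqrD5.
- by move=> b; rewrite integralT_sqrD_exprN2.
Qed.

Lemma plane_integral_f7 (R : realType) (phi theta : R) :
  0 < dirPsi phi theta ->
  (\int[(@lebesgue_measure R \x @lebesgue_measure R)%E]_p (f 7 phi theta p)%:E
    = (2 * pi / (5 * dirPsi phi theta ^+ 5))%:E)%E.
Proof.
move=> P0; have Pn : dirPsi phi theta != 0 by rewrite gt_eqF.
rewrite (@plane_integral_f R 7 3 phi theta (16 / 15) (3 * pi / (8 * dirPsi phi theta ^+ 5)))//.
- by congr EFin; field.
- by move=> q a q0; rewrite integralT_sqrt_sqrD7.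
- by move=> b; rewrite integralT_sqrD_exprN3.
Qed.

Lemma rect_integral_f3_cvg (R : realType) (phi theta : R) :
  0 < dirPsi phi theta ->
  rect_integral L.1 L.2 (f 3 phi theta) @[L --> real_pairs_to_infinity R] -->
  2 * pi / dirPsi phi theta.
Proof.
move=> P0; apply: rect_integral_cvg; [exact: measurable_f|exact: f_ge0|].
exact: plane_integral_f3.
Qed.

Lemma rect_integral_F (R : realType) (r lambda phi theta a b : R) :
  0 < dirPsi phi theta ->
  rect_integral a b (F r lambda phi theta) =
    rect_integral a b (f 3 phi theta)
    - 1 / (wavenumber lambda ^+ 2 * r ^+ 2) * rect_integral a b (f 5 phi theta)
    + 1 / (wavenumber lambda ^+ 4 * r ^+ 4) * rect_integral a b (f 7 phi theta).
Proof.
move=> P0; rewrite /rect_integral.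
set D := _ `*` _.
have mD : measurable D by exact: measurableX.
have i3 := @integrable_f R 3 phi theta _ D mD (plane_integral_f3 R _ _ P0).
have i5 := @integrable_f R 5 phi theta _ D mD (plane_integral_f5 R _ _ P0).
have i7 := @integrable_f R 7 phi theta _ D mD (plane_integral_f7 R _ _ P0).
exact: Rintegral_lincomb3.
Qed.

Lemma rect_integral_F_cvg (R : realType) (r lambda phi theta : R) :
  0 < dirPsi phi theta ->
  rect_integral L.1 L.2 (F r lambda phi theta) @[L --> real_pairs_to_infinity R] -->
  2 * pi / dirPsi phi theta
  - 1 / (wavenumber lambda ^+ 2 * r ^+ 2) * (2 * pi / (3 * dirPsi phi theta ^+ 3))
  + 1 / (wavenumber lambda ^+ 4 * r ^+ 4) * (2 * pi / (5 * dirPsi phi theta ^+ 5)).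
Proof.
move=> P0.
under eq_fun do rewrite rect_integral_F//.
apply: cvgD; first (apply: cvgB; first exact: rect_integral_f3_cvg).
- apply: cvgM; first exact: cvg_cst.
  apply: rect_integral_cvg; [exact: measurable_f|exact: f_ge0|].
  exact: plane_integral_f5.
- apply: cvgM; first exact: cvg_cst.
  apply: rect_integral_cvg; [exact: measurable_f|exact: f_ge0|].
  exact: plane_integral_f7.
Qed.

(** * Filters of pairs tending to infinity, and their rescaling *)

Global Instance real_pairs_to_infinity_proper (R : realType) :
  ProperFilter (real_pairs_to_infinity R).
Proof. exact: filter_prod_proper. Qed.

(** Odd pairs exist beyond any two thresholds, so the restricted filter is not degenerate.
    Properness makes the limits along it unique. *)
Global Instance odd_pairs_to_infinity_proper : ProperFilter odd_pairs_to_infinity.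
Proof.
apply: Build_ProperFilter_ex.
move=> P [[A B] /= [[N _ hN] [M _ hM]] ABP].
exists (N.*2.+1, M.*2.+1); apply: (ABP (_, _)) => /=.
  by split; [apply: hN | apply: hM]; rewrite /= -addnn -addSn leq_addl.
by rewrite !odd_double.
Qed.

(** The half-sides of the discrete array are the element counts times k = d / (2 r), so limits over
    rectangles are pulled back along this map. *)
Lemma odd_pairs_scale_cvg (R : realType) (k : R) : 0 < k ->
  (M.1%:R * k, M.2%:R * k) @[M --> odd_pairs_to_infinity] -->
  real_pairs_to_infinity R.
Proof.
move=> k0; have ck : x * k @[x --> +oo] --> +oo.
  by apply: gt0_cvgMly => //; exact: cvg_id.
(* Restriction to odd pairs refines the filter, so convergence along all pairs suffices. *)
apply: (@cvg_trans _ ((M.1%:R * k, M.2%:R * k) @[M --> filter_prod \oo \oo])).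
  by apply: cvg_app; exact: cvg_within.
apply: (@cvg_pair _ _ _ _ (pinfty_nbhs R) (pinfty_nbhs R)) => /=.
- exact: (cvg_comp _ _ (cvg_comp _ _ cvg_fst cvgr_idn) ck).
- exact: (cvg_comp _ _ (cvg_comp _ _ cvg_snd cvgr_idn) ck).
Qed.

Lemma real_pairs_scale_cvg (R : realType) (k : R) : 0 < k ->
  (L.1 * k, L.2 * k) @[L --> real_pairs_to_infinity R] -->
  real_pairs_to_infinity R.
Proof.
move=> k0; have ck : x * k @[x --> +oo] --> +oo.
  by apply: gt0_cvgMly => //; exact: cvg_id.
apply: (@cvg_pair _ _ _ _ (pinfty_nbhs R) (pinfty_nbhs R)) => /=.
- exact: (cvg_comp _ _ cvg_fst ck).
- exact: (cvg_comp _ _ cvg_snd ck).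
Qed.

(** * Numerical bounds on pi *)

(** The mean value theorem for atan - p on [0, 1], p a polynomial, compares pi / 4 with p(1) through
    the sign of 1 / (1 + x^2) - p'. The two choices of p give p(1) = 82/105 > 31/40 and p(1) =
    4/5. *)
Lemma pi_bounds (R : realType) : 31 / 10 <= (pi : R) <= 32 / 10.
Proof.
have mvt (p dp : R -> R) : (forall x : R, is_derive x 1 p (dp x)) -> p 0 = 0 ->
    exists2 c : R, 0 <= c <= 1 & pi / 4 - p 1 = (1 + c ^+ 2)^-1 - dp c.
  move=> dpE p0.
  have dD (x : R) : is_derive x 1 (fun x => atan x - p x) ((1 + x ^+ 2)^-1 - dp x).
    have h := dpE x.
    apply: is_derive_eq; by [].
  have cD : continuous (fun x => atan x - p x).
    move=> x; apply/differentiable_continuous/derivable1_diffP.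
    exact: (@ex_derive _ _ _ _ _ _ _ (dD x)).
  have [c /[!in_itv]/= /andP[c0 c1]] :=
    MVT ltr01 (fun x _ => dD x) (continuous_subspaceT cD).
  rewrite atan1 atan0 p0 !subr0 mulr1 => h.
  by exists c => //; rewrite !ltW.
have sqr_gt0 (c : R) : 0 < 1 + c ^+ 2 by rewrite ltr_wpDr ?sqr_ge0.
(* Hermite interpolants of 1 / (1 + y), y = x^2, at 0 and 1, integrated in x:
   1 - (1 + y) p(y) = y^2 (1 - y)^2 / 4 and 1 - (1 + y) q(y) = - y (1 - y)^2 / 4 *)
apply/andP; split.
- have [||c /andP[c0 c1] hc] := mvt
    (fun x => x - x ^+ 3 / 3 + 3 / 20 * x ^+ 5 - x ^+ 7 / 28)
    (fun x => (4 - 4 * x ^+ 2 + 3 * x ^+ 4 - x ^+ 6) / 4).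
  + by move=> x; apply: is_derive_eq; rewrite /GRing.scale/=; field.
  + by rewrite !expr0n /=; ring.
  have := sqr_gt0 c => s0.
  have : 0 <= (1 + c ^+ 2)^-1 - (4 - 4 * c ^+ 2 + 3 * c ^+ 4 - c ^+ 6) / 4.
    rewrite (_ : _ - _ = (c ^+ 2 * (1 - c ^+ 2)) ^+ 2 / 4 / (1 + c ^+ 2)); last first.
      by field; rewrite gt_eqF.
    by rewrite !divr_ge0 ?sqr_ge0 ?ltW.
  by rewrite -hc !expr1n; lra.
- have [||c /andP[c0 c1] hc] := mvt
    (fun x => x - x ^+ 3 / 4 + x ^+ 5 / 20)
    (fun x => (4 - 3 * x ^+ 2 + x ^+ 4) / 4).
  + by move=> x; apply: is_derive_eq; rewrite /GRing.scale/=; field.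
  + by rewrite !expr0n /=; ring.
  have := sqr_gt0 c => s0.
  have : (1 + c ^+ 2)^-1 - (4 - 3 * c ^+ 2 + c ^+ 4) / 4 <= 0.
    rewrite -subr_ge0 sub0r [leRHS](_ : _ = (c * (1 - c ^+ 2)) ^+ 2 / 4 / (1 + c ^+ 2)); last first.
      by field; rewrite gt_eqF.
    by rewrite !divr_ge0 ?sqr_ge0 ?ltW.
  by rewrite -hc !expr1n; lra.
Qed.

(** The tolerance is half a unit of the second decimal, which is what rounding to 0.12 means. *)
Lemma sqrt320_div_pi_approx (R : realType) :
  `|Num.sqrt (3 / 20) / pi - 12 / 100 :> R| <= 5 / 1000.
Proof.
have /andP[pl pu] := pi_bounds R.
have p0 : 0 < (pi : R) by exact: pi_gt0.
have sE : Num.sqrt (3 / 20 : R) ^+ 2 = 3 / 20 by rewrite sqr_sqrtr //; lra.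
have s0 : 0 <= Num.sqrt (3 / 20 : R) by exact: sqrtr_ge0.
move: s0 sE; set s := Num.sqrt _ => s0 sE.
(* 0.3875 is 0.125 times the lower bound 3.1 of pi; 0.38 exceeds 0.115 times the upper bound 3.2. *)
have s1 : s <= 3875 / 10000 by nra.
have s2 : 38 / 100 <= s by nra.
have h1 : s / pi <= 125 / 1000 by rewrite ler_pdivrMr//; nra.
have h2 : 115 / 1000 <= s / pi by rewrite ler_pdivlMr//; nra.
by rewrite ler_norml; lra.
Qed.

(** * Gains *)

Lemma discrete_gain_cvg (R : realType) (r phi theta A d Rrad l : R)
    (g : R * R -> R) :
  0 < r -> 0 < d ->
  rect_integral L.1 L.2 g @[L --> real_pairs_to_infinity R] --> l ->
  discrete_gain r phi theta A d Rrad g @ odd_pairs_to_infinity -->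
  eta R / (8 * Rrad) * (A * dirPsi phi theta / (4 * pi * d ^+ 2)) * l.
Proof.
move=> r0 d0 gl; apply: cvgM; first exact: cvg_cst.
have k0 : 0 < d / r / 2 by rewrite !divr_gt0.
have := cvg_comp _ _ (odd_pairs_scale_cvg R _ k0) gl.
by apply: cvg_trans; apply: near_eq_cvg; apply: nearW => M /=; rewrite !mulrA.
Qed.

Lemma continuous_gain_cvg (R : realType) (r phi theta Rrad l : R)
    (g : R * R -> R) :
  0 < r ->
  rect_integral L.1 L.2 g @[L --> real_pairs_to_infinity R] --> l ->
  continuous_gain r phi theta Rrad g @ real_pairs_to_infinity R -->
  eta R / (8 * Rrad) * (dirPsi phi theta / (4 * pi)) * l.
Proof.
move=> r0 gl; apply: cvgM; first exact: cvg_cst.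
have k0 : 0 < (2 * r)^-1 by rewrite invr_gt0 mulr_gt0.
exact: (cvg_comp _ _ (real_pairs_scale_cvg R _ k0) gl).
Qed.

(** The constants are 12 = 4 * 3 and 80 = 16 * 5: the factors 4 and 16 come from the powers of 2 pi
    / lambda, and 3 and 5 from the integrals of [f 5] and [f 7]. *)
Lemma plane_integral_F_ratio (R : realType) (r lambda Psi : R) :
  0 < r -> 0 < lambda -> 0 < Psi ->
  (2 * pi / Psi
   - 1 / (wavenumber lambda ^+ 2 * r ^+ 2) * (2 * pi / (3 * Psi ^+ 3))
   + 1 / (wavenumber lambda ^+ 4 * r ^+ 4) * (2 * pi / (5 * Psi ^+ 5)))
  / (2 * pi / Psi) =
  1 - 1 / (12 * pi ^+ 2) * (lambda ^+ 2 / (r ^+ 2 * Psi ^+ 2))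
    + 1 / (80 * pi ^+ 4) * (lambda ^+ 4 / (r ^+ 4 * Psi ^+ 4)).
Proof.
rewrite /wavenumber; move: (pi : R) (@pi_gt0 R) => p p0 r0 l0 P0.
by field; rewrite !gt_eqF.
Qed.

Lemma gain_ratio_lt1 (R : realType) (r lambda Psi : R) :
  0 < r -> 0 < lambda -> 0 < Psi ->
  Num.sqrt (3 / 20) * (lambda / pi) < r * Psi ->
  1 - 1 / (12 * pi ^+ 2) * (lambda ^+ 2 / (r ^+ 2 * Psi ^+ 2))
    + 1 / (80 * pi ^+ 4) * (lambda ^+ 4 / (r ^+ 4 * Psi ^+ 4)) < 1.
Proof.
move: (pi : R) (@pi_gt0 R) => p p0 r0 l0 P0 h.
pose y := (lambda / (p * r * Psi)) ^+ 2.
have y0 : 0 < y by rewrite exprn_gt0// divr_gt0// !mulr_gt0.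
have y1 : y < 20 / 3.
  (* Squaring the hypothesis gives (3/20) (lambda / p)^2 < (r Psi)^2, which is y < 20/3. *)
  have : (Num.sqrt (3 / 20) * (lambda / p)) ^+ 2 < (r * Psi) ^+ 2.
    have h0 : 0 <= Num.sqrt (3 / 20) * (lambda / p).
      by rewrite mulr_ge0 ?sqrtr_ge0// divr_ge0// ltW.
    have b0 : 0 <= r * Psi by rewrite mulr_ge0// ltW.
    by rewrite ltr_pXn2r.
  rewrite exprMn sqr_sqrtr => [{}h|]; last lra.
  rewrite /y (_ : lambda / _ = lambda / p / (r * Psi)); last first.
    by field; rewrite !gt_eqF.
  by rewrite expr_div_n ltr_pdivrMr ?exprn_gt0 ?mulr_gt0//; lra.
rewrite (_ : _ + _ = 1 - y / 12 + y ^+ 2 / 80); first nra.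
by rewrite /y; field; rewrite !gt_eqF.
Qed.

(** [hPsi] excludes a degenerate direction: at Psi = 0 every gain carries the factor Psi and
    vanishes, so the ratio 0 / 0 evaluates to 0 while the right-hand side evaluates to 1. *)
Theorem mainTheorem3 (R : realType) (r phi theta lambda A d Rrad : R)
    (hr : 0 < r) (hphi : 0 <= phi <= pi) (htheta : 0 <= theta <= pi)
    (hPsi : dirPsi phi theta != 0)
    (hlambda : 0 < lambda) (hA : 0 < Num.sqrt A) (hd : Num.sqrt A <= d)
    (hRrad : 0 < Rrad) :
  gains_exist r phi theta lambda A d Rrad /\
  [/\ G_eva r phi theta lambda A d Rrad / G_rad r phi theta A d Rrad =
        1 - 1 / (12 * pi ^+ 2)
              * (lambda ^+ 2 / (r ^+ 2 * dirPsi phi theta ^+ 2))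
          + 1 / (80 * pi ^+ 4)
              * (lambda ^+ 4 / (r ^+ 4 * dirPsi phi theta ^+ 4)),
      Num.sqrt (3 / 20) * (lambda / pi) < r * dirPsi phi theta ->
        G_eva r phi theta lambda A d Rrad / G_rad r phi theta A d Rrad < 1,
      `|Num.sqrt (3 / 20) / pi - 12 / 100 :> R| <= 5 / 1000
    & Gt_eva r phi theta lambda Rrad / Gt_rad r phi theta Rrad =
        1 - 1 / (12 * pi ^+ 2)
              * (lambda ^+ 2 / (r ^+ 2 * dirPsi phi theta ^+ 2))
          + 1 / (80 * pi ^+ 4)
              * (lambda ^+ 4 / (r ^+ 4 * dirPsi phi theta ^+ 4))].
Proof.
(* Both sines are nonnegative on [0, pi], so a nonzero Psi is positive. *)
have Psi0 : 0 < dirPsi phi theta.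
  by rewrite lt0r hPsi mulr_ge0// sin_ge0_pi.
have d0 : 0 < d by exact: lt_le_trans hd.
have A0 : 0 < A by rewrite -sqrtr_gt0.
have pi0 := @pi_gt0 R.
have cF := rect_integral_F_cvg R r lambda phi theta Psi0.
have c3 := rect_integral_f3_cvg R phi theta Psi0.
have dF := discrete_gain_cvg R r phi theta A d Rrad _ _ hr d0 cF.
have d3 := discrete_gain_cvg R r phi theta A d Rrad _ _ hr d0 c3.
have tF := continuous_gain_cvg R r phi theta Rrad _ _ hr cF.
have t3 := continuous_gain_cvg R r phi theta Rrad _ _ hr c3.
have dFE := cvg_lim (@Rhausdorff R) dF.
have d3E := cvg_lim (@Rhausdorff R) d3.
have tFE := cvg_lim (@Rhausdorff R) tF.
have t3E := cvg_lim (@Rhausdorff R) t3.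
have ratio := plane_integral_F_ratio R r lambda _ hr hlambda Psi0.
(* Each pair of gains shares a nonzero prefactor; once it cancels, both arrays leave the same ratio
   of plane integrals. *)
have ratioM (k x y : R) : k != 0 -> k * x / (k * y) = x / y.
  by move=> k0; rewrite -mulf_div divff// mul1r.
have eta0 : eta R / (8 * Rrad) != 0.
  by rewrite gt_eqF// divr_gt0// mulr_gt0.
have pi4_gt0 : 0 < 4 * pi :> R by rewrite mulr_gt0.
have ratio_d : G_eva r phi theta lambda A d Rrad / G_rad r phi theta A d Rrad =
    1 - 1 / (12 * pi ^+ 2) * (lambda ^+ 2 / (r ^+ 2 * dirPsi phi theta ^+ 2))
      + 1 / (80 * pi ^+ 4) * (lambda ^+ 4 / (r ^+ 4 * dirPsi phi theta ^+ 4)).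
  rewrite /G_eva /G_rad dFE d3E ratioM//.
  by rewrite mulf_neq0// gt_eqF// divr_gt0// mulr_gt0// exprn_gt0.
split.
  by split; rewrite /G_eva /G_rad /Gt_eva /Gt_rad ?dFE ?d3E ?tFE ?t3E.
split.
- exact: ratio_d.
- by move=> h; rewrite ratio_d; exact: gain_ratio_lt1.
- exact: sqrt320_div_pi_approx.
- rewrite /Gt_eva /Gt_rad tFE t3E ratioM//.
  by rewrite mulf_neq0// gt_eqF// divr_gt0.
Qed.
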